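(* For all $n\ge 1$, $L(n)\subseteq B(n)$. In particular, $\ell(n)=|L(n)|\le F_n$ for all $n\ge 1$, where $F_n$ is the $n$-th Fibonacci number ($F_1=F_2=1$, $F_n=F_{n-1}+F_{n-2}$).
   Context: Fix a field $K$. Let $R=K[x_1,\dots,x_m]$ be a polynomial ring (any $m\ge 0$) with standard grading $\deg x_i=1$, and let $I$ be a homogeneous ideal with $R/I$ of Krull dimension zero. The Hilbert function is $H_{R/I}(t)=\dim_K (R/I)_t$; if $s$ is the largest integer with $H_{R/I}(s)\neq 0$, the $h$-vector of $R/I$ is $(H_{R/I}(0),H_{R/I}(1),\dots,H_{R/I}(s))$. An $h$-vector is any integer vector arising this way. For $n\ge1$, $L(n)$ is the set of $h$-vectors whose entries sum to $n$, and $\ell(n)=|L(n)|$. The sets $B(n)$ are defined recursively: $B(1)=\{(1)\}$, $B(2)=\{(1,1)\}$, and for $n\ge 3$, $B(n)=C(n)\cup D(n)$ with $C(n)=\{(1,t_1,\dots,t_s,1) : (1,t_1,\dots,t_s)\in B(n-1)\}$ and $D(n)=\{(1,t_1,\dots,t_{s-1},t_s+1) : (1,t_1,\dots,t_s)\in B(n-1),\ t_{s-1}>1 \text{ or } s=1\}$. *)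

(* Defs.v *)
From HB Require Import structures.
From mathcomp Require Import all_boot all_order all_algebra.
From mathcomp Require Import finmap mpoly classical_sets cardinality.

Set Implicit Arguments.
Unset Strict Implicit.
Unset Printing Implicit Defensive.

Import GRing.Theory.

Local Open Scope ring_scope.
Local Open Scope quotient_scope.
Local Open Scope classical_set_scope.

(* [idealr A] and [prime_idealr A] are types of bool-valued predicates on A;
   under the classical axioms of mathcomp.classical.boolp they comprise all
   the proper (resp. prime) ideals of the commutative ring A. *)

(* A strict chain P 0 < P 1 < ... < P k of prime ideals, of length k; the
   values P i with i > k play no role. *)
Definition has_prime_chain (A : comNzRingType) (k : nat) : Prop :=
  exists P : nat -> prime_idealr A, forall i : nat, (i < k)%N ->
    {subset P i <= P i.+1} /\ ~ {subset P i.+1 <= P i}.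

Definition krull_dim (A : comNzRingType) (d : nat) : Prop :=
  has_prime_chain A d /\
  forall k : nat, has_prime_chain A k -> (k <= d)%N.

Section HilbertFunction.

Variables (K : fieldType) (m : nat).

Definition homogeneous_ideal (I : idealr {mpoly K[m]}) : Prop :=
  forall (f : {mpoly K[m]}) (t : nat), f \in I -> pihomog mdeg t f \in I.

Variable I : idealr {mpoly K[m]}.

(* K[x_1, ..., x_m] / I; its K-vector space structure, which {ideal_quot I}
   does not carry, is the one for which the projection is K-linear. *)
Definition quot_alg : Type := {ideal_quot I}.

HB.instance Definition _ := GRing.ComNzRing.on quot_alg.

Definition quot_pi (f : {mpoly K[m]}) : quot_alg := \pi_({ideal_quot I}) f.

Definition quot_scale (c : K) (x : quot_alg) : quot_alg := quot_pi c%:MP * x.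

Fact quot_scaleA (a b : K) (x : quot_alg) :
  quot_scale a (quot_scale b x) = quot_scale (a * b) x.
Proof. by rewrite /quot_scale /quot_pi mulrA mpolyCM rmorphM. Qed.

Fact quot_scale1 : left_id 1 quot_scale.
Proof. by move=> x; rewrite /quot_scale /quot_pi mpolyC1 rmorph1 mul1r. Qed.

Fact quot_scaleDr : right_distributive quot_scale +%R.
Proof. by move=> c x y; rewrite /quot_scale mulrDr. Qed.

Fact quot_scaleDl (x : quot_alg) : {morph quot_scale^~ x : a b / a + b}.
Proof. by move=> a b; rewrite /quot_scale /quot_pi mpolyCD rmorphD mulrDl. Qed.

HB.instance Definition _ := GRing.Zmodule_isLmodule.Build K quot_alg
  quot_scaleA quot_scale1 quot_scaleDr quot_scaleDl.

Fact quot_pi_is_linear : linear quot_pi.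
Proof. by move=> c f g; rewrite -mul_mpolyC /quot_pi rmorphD rmorphM. Qed.

Definition quot_deg (t : nat) : set quot_alg :=
  [set quot_pi f | f in [set f : {mpoly K[m]} | f \is t.-homog]].

End HilbertFunction.

Arguments quot_deg {K m} I t.

Definition has_dim (K : fieldType) (V : lmodType K) (W : set V) (d : nat) :
    Prop :=
  exists b : 'I_d -> V,
    [/\ forall i, W (b i),
        forall x, W x -> exists c : 'I_d -> K, x = \sum_(i < d) c i *: b i
      & forall c : 'I_d -> K,
          \sum_(i < d) c i *: b i = 0 -> forall i, c i = 0].

Definition hilbert_function (K : fieldType) (m : nat)
    (I : idealr {mpoly K[m]}) (H : nat -> nat) : Prop :=
  forall t : nat, has_dim (quot_deg I t) (H t).

Definition is_h_vector_of (K : fieldType) (m : nat)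
    (I : idealr {mpoly K[m]}) (h : seq nat) : Prop :=
  exists (H : nat -> nat) (s : nat),
    [/\ hilbert_function I H,
        H s <> 0%N,
        forall t : nat, H t <> 0%N -> (t <= s)%N
      & h = [seq H t | t <- iota 0 s.+1]].

Definition is_h_vector (K : fieldType) (h : seq nat) : Prop :=
  exists (m : nat) (I : idealr {mpoly K[m]}),
    [/\ homogeneous_ideal I,
        krull_dim (quot_alg I) 0
      & is_h_vector_of I h].

Definition L (K : fieldType) (n : nat) : set (seq nat) :=
  [set h | is_h_vector K h /\ sumn h = n].

(* [fset_set] is the empty set on infinite sets, so this is the cardinality
   of [L K n] only once [finite_set (L K n)] is known. *)
Definition ell (K : fieldType) (n : nat) : nat := #|` fset_set (L K n)|.

Local Open Scope nat_scope.

Definition extend_one (X : set (seq nat)) : set (seq nat) :=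
  [set v | exists t : seq nat, X (1 :: t) /\ v = 1 :: rcons t 1].

(* Here (1, t_1, ..., t_s) is 1 :: rcons t a, so a is t_s, the case s = 1 is
   t = [::], and otherwise t_(s-1) is last 0 t. *)
Definition increment_last (X : set (seq nat)) : set (seq nat) :=
  [set v | exists (t : seq nat) (a : nat),
     [/\ X (1 :: rcons t a),
         1 < last 0 t \/ t = [::]
       & v = 1 :: rcons t a.+1]].

(* The value at n = 0 is irrelevant. *)
Fixpoint B (n : nat) : set (seq nat) :=
  match n with
  | 0 => set0
  | 1 => [set [:: 1]]
  | 2 => [set [:: 1; 1]]
  | n'.+1 => extend_one (B n') `|` increment_last (B n')
  end.

Fixpoint fib (n : nat) : nat :=
  match n with
  | 0 => 0
  | 1 => 1
  | (k.+1 as n').+1 => fib n' + fib k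
  end.

(* Main.v *)
(** Only three facts about [A = R/I] matter: [A_0] is a line; [A_t = 0] forces
    [A_(t+1) = 0]; and, for [t >= 1], if [A_t] is a line then it is spanned by
    a monomial [x_j w], so that [x_i x_j w = x_j (x_i w)] lies in [x_j A_t] for
    every [i], and [A_(t+1)] is spanned by [x_j x_j w].  Hence an h-vector is
    [1] followed by positive integers in which nothing exceeds [1] after a [1].
    Such sequences lie in [B n], by removing or decrementing the last entry,
    and they are counted by the Fibonacci recurrence. *)
From HB Require Import structures.
Require Import Defs.
From mathcomp Require Import all_boot all_order all_algebra.
From mathcomp Require Import finmap mpoly boolp classical_sets cardinality.
From mathcomp Require Import zify.

Set Implicit Arguments.
Unset Strict Implicit.
Unset Printing Implicit Defensive.

Import GRing.Theory.

(** * Bases of dimension at most one *)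

Section Dimension.

Local Open Scope ring_scope.
Local Open Scope classical_set_scope.

Variables (K : fieldType) (V : lmodType K) (W : set V).

Lemma has_dim_eq0 (d : nat) : has_dim W d -> W `<=` [set 0] -> d = 0%N.
Proof.
case: d => // d [b [Wb _ free_b]] W0; exfalso.
have /(_ (fun=> 1)) /(_ _ ord0) := free_b.
rewrite big1 => [/(_ erefl)/eqP|i _]; first by rewrite oner_eq0.
by rewrite (W0 _ (Wb i)) scaler0.
Qed.

Lemma has_dim0 : has_dim W 0 -> W `<=` [set 0].
Proof. by case=> b [_ gen_b _] x /gen_b [c ->]; rewrite big_ord0. Qed.

Lemma has_dim_line (v : V) (d : nat) :
  has_dim W d -> (forall x, W x -> exists c, x = c *: v) -> (d <= 1)%N.
Proof.
case: d => [|[|d]] // [b [Wb _ free_b]] line; exfalso.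
have [c0 b0E] := line _ (Wb ord0).
have [c1 b1E] := line _ (Wb (lift ord0 ord0)).
have free01 a0 a1 : a0 *: b ord0 + a1 *: b (lift ord0 ord0) = 0 -> a0 = 0 /\ a1 = 0.
  move=> rel; pose c (i : 'I_d.+2) : K := nth 0 [:: a0; a1] i.
  have /free_b c0' : \sum_(i < d.+2) c i *: b i = 0.
    by rewrite 2!big_ord_recl big1 ?addr0 // => i _; rewrite /c /= nth_nil scale0r.
  by split; [have := c0' ord0 | have := c0' (lift ord0 ord0)].
(* The two basis vectors are [c0 *: v] and [c1 *: v], so the coefficients [c1] and [- c0] give a
   relation. Freeness forces [c0 = 0], which makes the first basis vector zero. *)
have [|c1_0 /eqP] := free01 c1 (- c0).
  by rewrite b0E b1E !scalerA mulNr mulrC scaleNr subrr.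
rewrite oppr_eq0 => /eqP c0_0.
have [|/eqP] := free01 1 0; last by rewrite oner_eq0.
by rewrite b0E c0_0 !scale0r scaler0 addr0.
Qed.

Lemma has_dim1 (u : V) :
  has_dim W 1 -> W u -> u <> 0 -> forall x, W x -> exists c, x = c *: u.
Proof.
case=> b [_ gen_b _] Wu u0 x Wx.
have [c xE] := gen_b _ Wx; have [e uE] := gen_b _ Wu.
rewrite !big_ord1 in xE uE.
have e0 : e ord0 != 0 by apply/eqP => e0; apply: u0; rewrite uE e0 scale0r.
by exists (c ord0 / e ord0); rewrite uE scalerA divfK.
Qed.

End Dimension.

(** * Growth of the Hilbert function *)

Section HilbertFunction.

Local Open Scope ring_scope.
Local Open Scope classical_set_scope.

Variables (K : fieldType) (m : nat) (I : idealr {mpoly K[m]}).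

HB.instance Definition _ :=
  GRing.isLinear.Build K {mpoly K[m]} (quot_alg I) _ (@quot_pi K m I)
    (@quot_pi_is_linear K m I).

Lemma quot_piM (f g : {mpoly K[m]}) : quot_pi I (f * g) = quot_pi I f * quot_pi I g.
Proof. by rewrite /quot_pi rmorphM. Qed.

Lemma quot_pi1 : quot_pi I 1 = 1.
Proof. by rewrite /quot_pi rmorph1. Qed.

Lemma quot_scaleAr (c : K) (x y : quot_alg I) : x * (c *: y) = c *: (x * y).
Proof. exact: mulrCA. Qed.

Lemma quot_degX (w : 'X_{1..m}) : quot_deg I (mdeg w) (quot_pi I 'X_[w]).
Proof. by exists 'X_[w] => //=; rewrite dhomogX. Qed.

(** The images of the monomials of degree [t] span this piece. With [v := 0] this is a vanishing
    criterion. *)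
Lemma quot_deg_line (t : nat) (v : quot_alg I) :
  (forall w : 'X_{1..m}, mdeg w = t -> exists c, quot_pi I 'X_[w] = c *: v) ->
  forall x, quot_deg I t x -> exists c, x = c *: v.
Proof.
move=> monl x [f /= /dhomogP hf <-]; rewrite (mpolyE f).
rewrite raddf_sum /= big_seq.
elim/big_ind: _ => [|y z [a ->] [b ->]|w wf].
- by exists 0; rewrite scale0r.
- by exists (a + b); rewrite scalerDl.
- have [c] := monl w (hf w wf).
  by move=> wE; exists (f@_w * c); rewrite linearZ /= wE scalerA.
Qed.

Lemma mnm_split (w : 'X_{1..m}) (t : nat) :
  mdeg w = t.+1 -> exists i (w' : 'X_{1..m}), w = (U_(i) + w')%MM /\ mdeg w' = t.
Proof.
move=> wt; have [i wi] : exists i, w i != 0%N.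
  apply/existsP; apply: contra_eqT wt; rewrite negb_exists => /forallP w0.
  by rewrite mdegE big1 // => i _; apply/eqP; rewrite -[_ == _]negbK.
have wE : w = (U_(i) + (w - U_(i)))%MM by rewrite addmC submK ?lep1mP.
exists i, (w - U_(i))%MM; split=> //.
by move: wt; rewrite {1}wE mdegD mdeg1 => -[].
Qed.

Variables (H : nat -> nat) (dimH : hilbert_function I H).

Lemma hilbert_function0 : H 0 = 1%N.
Proof.
have H0_le1 : (H 0 <= 1)%N.
  apply: (has_dim_line (v := quot_pi I 1) (dimH 0)); apply: quot_deg_line => w /eqP.
  by rewrite mdeg_eq0 => /eqP ->; exists 1; rewrite scale1r mpolyX0.
case H0E: (H 0) H0_le1 (dimH 0) => [|[|//]] // _ /has_dim0 /(_ 1) /= one0.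
have /one0/eqP : quot_deg I 0 1.
  by exists 1; [exact: dhomog1 | exact: quot_pi1].
by rewrite oner_eq0.
Qed.

Lemma hilbert_function_eq0 (t : nat) : H t = 0%N -> H t.+1 = 0%N.
Proof.
move=> Ht; have := dimH t; rewrite Ht => /has_dim0 At0.
apply: (has_dim_eq0 (dimH t.+1)) => x.
case/(quot_deg_line (v := 0)) => [w /mnm_split [i [w' [-> w't]]]|c ->].
  exists 0; rewrite mpolyXD quot_piM (At0 (quot_pi I 'X_[w'])) ?mulr0 ?scaler0 //.
  by rewrite -w't; apply: quot_degX.
exact: scaler0.
Qed.

Lemma hilbert_function_le1 (t : nat) :
  (0 < t)%N -> (H t <= 1)%N -> (H t.+1 <= 1)%N.
Proof.
case: t => // t _; case Ht: (H t.+1) => [|[|//]] // _.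
  by rewrite hilbert_function_eq0.
have := dimH t.+1; rewrite Ht => dimA.
have [w [wt w_neq0]] : exists w : 'X_{1..m}, mdeg w = t.+1 /\ quot_pi I 'X_[w] <> 0.
  apply: contrapT => /forallNP w0.
  suff : 1%N = 0%N by [].
  apply: (has_dim_eq0 dimA) => x.
  case/(quot_deg_line (v := 0)) => [w wt|c ->]; last exact: scaler0.
  exists 0; rewrite scaler0; apply: contrapT => w_neq0.
  by apply: (w0 w).
have Aw : quot_deg I t.+1 (quot_pi I 'X_[w]) by rewrite -wt; apply: quot_degX.
have lineA := has_dim1 dimA Aw w_neq0.
(* Since [w] has positive degree, it factors as [x_j u]; each [x_i u] has the degree of [w], hence
   is a multiple of [w] in the quotient. *)
have [j [u [wE ut]]] := mnm_split wt.
apply: (has_dim_line (v := quot_pi I ('X_j * 'X_[w])) (dimH t.+2)).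
apply: quot_deg_line => _ /mnm_split [i [w' [-> w't]]].
have [c w'E] : exists c, quot_pi I 'X_[w'] = c *: quot_pi I 'X_[w].
  by apply: lineA; rewrite -w't; apply: quot_degX.
have [d uE] : exists d, quot_pi I 'X_[U_(i) + u] = d *: quot_pi I 'X_[w].
  by apply: lineA; rewrite -ut -add1n -(mdeg1 i) -mdegD; apply: quot_degX.
have XiXw : 'X_i * 'X_[w] = 'X_j * 'X_[U_(i) + u] :> {mpoly K[m]}.
  by rewrite wE !mpolyXD mulrCA.
(* In the quotient, [x_i w' = c x_i w = c x_j (x_i u) = c d x_j w]. *)
exists (c * d); rewrite mpolyXD quot_piM w'E quot_scaleAr -quot_piM XiXw.
by rewrite quot_piM uE quot_scaleAr scalerA -quot_piM.
Qed.

End HilbertFunction.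

(** * Admissible sequences and the sets [B n] *)

Local Open Scope nat_scope.

(** Meant for an h-vector without its leading 1, since that 1 may be followed by a larger entry. *)
Definition admissible (t : seq nat) : bool :=
  all (leq 1) t && sorted (fun a b => (1 < a) || (b <= 1)) t.

Lemma admissible_rcons (t : seq nat) (a : nat) :
  admissible (rcons t a) =
  [&& admissible t, 0 < a & [|| nilp t, 1 < last 0 t | a <= 1]].
Proof.
rewrite /admissible all_rcons; case: t => [|b t] /=; first by rewrite !andbT.
by rewrite rcons_path /= [X in X && _ = _]andbC andbACA.
Qed.

Lemma h_vector_admissible (K : fieldType) (h : seq nat) :
  is_h_vector K h -> exists2 t, h = 1 :: t & admissible t.
Proof.
case=> m [I [_ _ [H [s [dimH Hs _ ->]]]]].
exists [seq H t | t <- iota 1 s]; first by rewrite /= (hilbert_function0 dimH).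
(* A zero in some degree up to [s] would propagate to [H s]. *)
have Hpos t : t <= s -> 0 < H t.
  move=> ts; rewrite lt0n; apply/eqP => Ht; apply: Hs.
  rewrite -(subnK ts); elim: (s - t) => [//|k IHk].
  by rewrite addSn (hilbert_function_eq0 dimH).
apply/andP; split.
  apply/allP => _ /mapP [t + ->]; rewrite mem_iota => /andP[_ ts].
  by apply: Hpos; rewrite -ltnS -add1n.
apply/(sortedP 0) => i; rewrite size_map size_iota => lt_is.
rewrite !(nth_map 0) ?size_iota ?(ltnW lt_is) // !nth_iota ?(ltnW lt_is) //.
(* Entry [i] is [H (1 + i)], so the degree is positive. *)
by case: ltnP => //= Hi; rewrite addnS (hilbert_function_le1 dimH).
Qed.

Lemma admissible_sub_B (n : nat) (t : seq nat) :
  admissible t -> sumn t = n -> B n.+1 (1 :: t).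
Proof.
elim: n t => [|n IHn] t.
  by case: t => [|a t] //= /andP[/andP[a_gt0 _] _]; lia.
case/lastP: t => [|t a]; first by [].
rewrite admissible_rcons => /and3P[adm a_gt0 ta] sumt.
rewrite sumn_rcons in sumt.
(* [B 2] is a base case of the recursion; here [t] must be empty and [a = 1]. *)
case: n => [|n] in IHn sumt *.
  have a1 : a = 1 by lia.
  case: t adm ta sumt => [|b t] /=; first by rewrite a1.
  by case/andP => /andP[b_gt0 _]; lia.
case: (leqP a 1) => [a_le1|a_gt1].
  left; exists t; have a1 : a = 1 by lia.
  by rewrite a1; split=> //; apply: IHn => //; lia.
right; exists t, a.-1; rewrite prednK //.
(* For [a > 1], admissibility leaves the side condition of [increment_last], which also keeps
   [rcons t a.-1] admissible. *)
have tE : nilp t || (1 < last 0 t) by move: ta; rewrite (leqNgt a) a_gt1 orbF.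
split=> //; last by case/orP: tE => [/nilP ->|]; [right | left].
apply: IHn; last by rewrite sumn_rcons; lia.
by rewrite admissible_rcons adm orbA tE /=; lia.
Qed.

(** * Counting by the Fibonacci recurrence *)

(* [take] and [last] give [incr_last [::]] the junk value [[:: 1]], never met:
   there is no empty composition of a positive integer. *)
Definition incr_last (t : seq nat) : seq nat :=
  rcons (take (size t).-1 t) (last 0 t).+1.

(** Compositions of [n] into parts at least 2, split by whether the last part exceeds 2. *)
Fixpoint big_compositions (n : nat) : seq (seq nat) :=
  match n with
  | 0 => [:: [::]]
  | 1 => [::]
  | (k.+1 as n').+1 => map incr_last (big_compositions n')
                       ++ map (rcons^~ 2) (big_compositions k)
  end.

(** An admissible sequence that does not end in 1 contains no 1, hence the second list. *)
Fixpoint admissible_seqs (n : nat) : seq (seq nat) :=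
  match n with
  | 0 => [:: [::]]
  | n'.+1 => map (rcons^~ 1) (admissible_seqs n') ++ big_compositions n
  end.

Lemma size_big_compositions (n : nat) : size (big_compositions n.+1) = fib n.
Proof.
(* The recurrence reaches back two steps, so two consecutive values are carried along. *)
suff [] : size (big_compositions n.+1) = fib n /\
          size (big_compositions n.+2) = fib n.+1 by [].
elim: n => [//|n [IHn IHn1]]; split=> //.
rewrite -[fib n.+2]/(fib n.+1 + fib n) -IHn -IHn1.
by rewrite [big_compositions n.+3]/= size_cat !size_map.
Qed.

Lemma size_admissible_seqs (n : nat) : size (admissible_seqs n) = fib n.+1.
Proof.
elim: n => // n IHn; rewrite [admissible_seqs _]/= size_cat size_map IHn.
by rewrite size_big_compositions.
Qed.

Lemma mem_big_compositions (n : nat) (t : seq nat) :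
  all (leq 2) t -> sumn t = n -> t \in big_compositions n.
Proof.
suff [] : (all (leq 2) t -> sumn t = n -> t \in big_compositions n) /\
   (all (leq 2) t -> sumn t = n.+1 -> t \in big_compositions n.+1) by [].
elim: n t => [|n IHn] t; [split|split; first by case: (IHn t)].
- by case: t => //= a t /andP[]; lia.
- by case: t => //= a t /andP[]; lia.
case/lastP: t => [//|t a]; rewrite all_rcons => /andP[a2 t2] sumt.
rewrite sumn_rcons in sumt; rewrite mem_cat.
case: (ltnP 2 a) => [a_gt2|a_le2]; apply/orP; [left|right].
  apply/mapP; exists (rcons t a.-1); last first.
    by rewrite /incr_last size_rcons last_rcons -[X in take _ X]cats1 take_size_cat // prednK //; lia.
  by apply: (IHn _).2; rewrite ?all_rcons ?sumn_rcons ?t2 ?andbT; lia.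
have -> : a = 2 by lia.
by apply: map_f; apply: (IHn _).1 => //; lia.
Qed.

Lemma mem_admissible_seqs (n : nat) (t : seq nat) :
  admissible t -> sumn t = n -> t \in admissible_seqs n.
Proof.
elim: n t => [|n IHn] t.
  by case: t => //= a t /andP[/andP[a_gt0 _] _]; lia.
case/lastP: t => [//|t a]; rewrite admissible_rcons => /and3P[adm a_gt0 ta] sumt.
have sumta := sumt; rewrite sumn_rcons in sumt; rewrite mem_cat.
case: (leqP a 1) => [a_le1|a_gt1]; apply/orP; [left|right].
  have -> : a = 1 by lia.
  by apply: map_f; apply: IHn => //; lia.
apply: mem_big_compositions => //; rewrite all_rcons a_gt1 /=.
rewrite (leqNgt a) a_gt1 orbF /= in ta.
(* From right to left, an entry above 1 forces its predecessor above 1. *)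
elim/last_ind: t adm ta {IHn sumt sumta} => [//|t b IHt].
rewrite admissible_rcons all_rcons /nilp size_rcons last_rcons /=.
case/and3P => adm _ tb b_gt1; rewrite b_gt1 IHt //.
by move: tb; rewrite (leqNgt b) b_gt1 orbF.
Qed.

Theorem theorem2p4 (K : fieldType) :
  (forall n : nat, (0 < n)%N -> (L K n `<=` B n)%classic) /\
  (forall n : nat, (0 < n)%N ->
     finite_set (L K n) /\ (ell K n <= fib n)%N).
Proof.
split=> -[//|n] _.
  move=> h [/h_vector_admissible [t -> adm] [sumt]].
  exact: admissible_sub_B.
have sub h : L K n.+1 h -> h \in map (cons 1) (admissible_seqs n).
  case=> /h_vector_admissible [t -> adm] [sumt].
  by apply: map_f; apply: mem_admissible_seqs.
have finL : finite_set (L K n.+1).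
  by apply: sub_finite_set (finite_seq (map (cons 1) (admissible_seqs n))).
(* The total is [n.+1]; without the leading 1 the sum is [n], and [admissible_seqs n] has size
   [fib n.+1]. *)
split=> //; rewrite -(size_admissible_seqs n) -(size_map (cons 1)).
apply: uniq_leq_size (fset_uniq _) _ => h.
by rewrite in_fset_set // => /set_mem /sub.
Qed.
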